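(* Let $Q$ be a Hausdorff, connected, locally path-connected space. The functor $D\mapsto D_Q$ from the category of discrete groups to the category of $Q$-groups admits a left adjoint (denoted by $\hat{\pi}_0$).
   Context: A $Q$-space is a Hausdorff, locally path-connected space $X$ with a continuous map $X\to Q$; morphisms are continuous maps commuting with the maps to $Q$. A $Q$-group is a group object in $Q$-spaces: a $Q$-space $G$ with continuous maps over $Q$ (multiplication $G\times_QG\to G$, unit $Q\to G$, inverse $G\to G$) making every fibre a group; morphisms of $Q$-groups are morphisms of $Q$-spaces that are fibrewise group morphisms. For a discrete group $D$, $D_Q$ denotes the $Q$-group $D\times Q\to Q$ (second projection) with fibrewise group law. *)

(* Defs.v *)
From HB Require Import structures.
From mathcomp Require Import all_boot all_order all_algebra.
From mathcomp Require Import all_classical all_reals all_analysis.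

Set Implicit Arguments.
Unset Strict Implicit.
Unset Printing Implicit Defensive.

Import Order.TTheory GRing.Theory Num.Theory.
Import numFieldNormedType.Exports.
Import Algebra.

Local Open Scope classical_set_scope.
Local Open Scope ring_scope.

Record category := Category {
  obj :> Type;
  hom : obj -> obj -> Type;
  idm : forall a, hom a a;
  comp : forall a b c, hom b c -> hom a b -> hom a c;
  comp_idl : forall a b (f : hom a b), comp (idm b) f = f;
  comp_idr : forall a b (f : hom a b), comp f (idm a) = f;
  compA : forall a b c d (h : hom c d) (g : hom b c) (f : hom a b),
    comp h (comp g f) = comp (comp h g) f }.

Arguments hom {C} a b : rename.
Arguments idm {C} a : rename.
Arguments comp {C a b c} g f : rename.

Record functor (C D : category) := Functor {
  fobj :> C -> D;
  fmap : forall a b : C, hom a b -> hom (fobj a) (fobj b);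
  fmap_id : forall a : C, fmap (idm a) = idm (fobj a);
  fmap_comp : forall (a b c : C) (g : hom b c) (f : hom a b),
    fmap (comp g f) = comp (fmap g) (fmap f) }.

Definition left_adjoint (C D : category) (L : functor C D) (F : functor D C) :=
  exists phi : forall (c : C) (d : D), hom (L c) d -> hom c (F d),
    (forall c d, bijective (phi c d)) /\
    (forall (c c' : C) (d d' : D) (u : hom c' c) (v : hom d d')
            (f : hom (L c) d),
       phi c' d' (comp v (comp f (fmap L u))) =
       comp (fmap F v) (comp (phi c d f) u)).

Definition admits_left_adjoint (C D : category) (F : functor D C) :=
  exists L : functor C D, left_adjoint L F.

Section groups.

Notation ghom G H := (UMagmaMorphism.type G H).

Lemma ghom_ext (G H : groupType) (f g : ghom G H) : f =1 g -> f = g.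
Proof.
move: f g => [f [[f1] [fM]]] [g [[g1] [gM]]] /= /funext fg.
case: _ / fg g1 gM => g1 gM.
by rewrite (Prop_irrelevance f1 g1) (Prop_irrelevance fM gM).
Qed.

Definition ghom_id (G : groupType) : ghom G G := [the ghom G G of idfun].

Definition ghom_comp (G H K : groupType) (g : ghom H K) (f : ghom G H) :
  ghom G K := [the ghom G K of g \o f].

Definition Groups : category.
Proof.
apply: (@Category groupType (fun G H => ghom G H) ghom_id ghom_comp).
- by move=> G H f; exact: ghom_ext.
- by move=> G H f; exact: ghom_ext.
- by move=> G H K L h g f; exact: ghom_ext.
Defined.

End groups.

Section path_connectedness.
Variables (R : realType) (X : topologicalType).

Definition path_connected (A : set X) := forall x y, A x -> A y ->
  exists g : R -> X, [/\ {within `[0, 1], continuous g},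
    g 0 = x, g 1 = y & forall t, `[0, 1]%classic t -> A (g t)].

Definition locally_path_connected := forall (x : X) (U : set X), nbhs x U ->
  exists V : set X, [/\ open_nbhs x V, V `<=` U & path_connected V].

End path_connectedness.

Section Qgroups.
Variables (R : realType) (Q : topologicalType).

Record Qspace := {
  total :> topologicalType;
  proj : total -> Q;
  total_hausdorff : hausdorff_space total;
  total_lpc : locally_path_connected R total;
  proj_continuous : continuous proj }.

Record Qmap (X Y : Qspace) := {
  qmap :> X -> Y;
  qmap_continuous : continuous qmap;
  qmap_proj : forall x, proj (qmap x) = proj x }.

(* As a type, [fibre_square X] carries the topology induced by X * X: it is
   the topological fibre product, which need not be locally path-connected. *)
Definition fibre_square (X : Qspace) : set (X * X) :=
  [set z | proj z.1 = proj z.2].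
Arguments fibre_square X : clear implicits.

Definition fpair (X : Qspace) (x y : X) (h : proj x = proj y) :
  fibre_square X :=
  exist (fun z => z \in fibre_square X) (x, y)
    (mem_set (h : fibre_square X (x, y))).

(* The proofs that two points lie in the same fibre are universally
   quantified in the group laws; they can all be derived from the
   hypotheses on x, y, z and from proj_mul, proj_one, proj_inv. *)
Record Qgroup := {
  qspace :> Qspace;
  qmul : fibre_square qspace -> qspace;
  qone : Q -> qspace;
  qinv : qspace -> qspace;
  qmul_continuous : continuous qmul;
  qone_continuous : continuous qone;
  qinv_continuous : continuous qinv;
  proj_mul : forall (x y : qspace) (h : proj x = proj y),
    proj (qmul (fpair h)) = proj x;
  proj_one : forall q, proj (qone q) = q;
  proj_inv : forall x, proj (qinv x) = proj x;
  qmulA : forall (x y z : qspace) (hxy : proj x = proj y)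
      (hyz : proj y = proj z)
      (hxy_z : proj (qmul (fpair hxy)) = proj z)
      (hx_yz : proj x = proj (qmul (fpair hyz))),
    qmul (fpair hx_yz) = qmul (fpair hxy_z);
  qmul1l : forall (x : qspace) (h : proj (qone (proj x)) = proj x),
    qmul (fpair h) = x;
  qmul1r : forall (x : qspace) (h : proj x = proj (qone (proj x))),
    qmul (fpair h) = x;
  qmulVl : forall (x : qspace) (h : proj (qinv x) = proj x),
    qmul (fpair h) = qone (proj x);
  qmulVr : forall (x : qspace) (h : proj x = proj (qinv x)),
    qmul (fpair h) = qone (proj x) }.

Record Qhom (G H : Qgroup) := {
  qhom :> Qmap G H;
  qhomM : forall (x y : G) (h : proj x = proj y)
      (h' : proj (qhom x) = proj (qhom y)),
    qhom (qmul (fpair h)) = qmul (fpair h') }.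

Lemma Qhom_ext (G H : Qgroup) (f g : Qhom G H) : f =1 g -> f = g.
Proof.
move: f g => [[f fc fp] fM] [[g gc gp] gM] /= /funext fg.
case: _ / fg gc gp gM => gc gp.
rewrite (Prop_irrelevance fc gc) (Prop_irrelevance fp gp) => gM.
by rewrite (Prop_irrelevance fM gM).
Qed.

Definition Qmap_id (X : Qspace) : Qmap X X.
Proof. by exists idfun => // x; exact: cvg_id. Defined.

Definition Qmap_comp (X Y Z : Qspace) (g : Qmap Y Z) (f : Qmap X Y) :
  Qmap X Z.
Proof.
exists (g \o f).
- by move=> x; apply: continuous_comp; exact: qmap_continuous.
- by move=> x /=; rewrite !qmap_proj.
Defined.

Definition Qhom_id (G : Qgroup) : Qhom G G.
Proof.
exists (Qmap_id G) => x y h h' /=.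
by rewrite (Prop_irrelevance h' h).
Defined.

Definition Qhom_comp (G H K : Qgroup) (g : Qhom H K) (f : Qhom G H) :
  Qhom G K.
Proof.
exists (Qmap_comp g f) => x y h h' /=.
have hf : proj (f x) = proj (f y) by rewrite !qmap_proj.
by rewrite (qhomM h hf) (qhomM hf h').
Defined.

Definition Qgroups : category.
Proof.
apply: (@Category Qgroup Qhom Qhom_id Qhom_comp).
- by move=> G H f; exact: Qhom_ext.
- by move=> G H f; exact: Qhom_ext.
- by move=> G H K L h g f; exact: Qhom_ext.
Defined.

End Qgroups.

Arguments fibre_square {R Q} X.

Section constant_Qgroup.
Variables (R : realType) (Q : topologicalType).
Hypotheses (hQ : hausdorff_space Q) (lQ : locally_path_connected R Q).

Lemma continuous_discr_pair (T : topologicalType) (D : choiceType)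
    (a : T -> discrete_topology D) (b : T -> Q) :
  (forall x, \forall y \near x, a y = a x) -> continuous b ->
  continuous (fun x => (a x, b x) : discrete_topology D * Q).
Proof.
move=> ha hb x; apply: (@cvg_pair _ _ _ _ (nbhs (a x)) (nbhs (b x))).
  by apply: (@cvg_near_cst _ (discrete_topology D) (a x)); exact: ha.
exact: hb.
Qed.

Lemma discr_fst_near (D : choiceType) (z : discrete_topology D * Q) :
  \forall w \near z, w.1 = z.1.
Proof.
exists ([set z.1], setT); first by split; [exact: discrete_set1|exact: filterT].
by move=> w [].
Qed.

Lemma constQ_hausdorff (D : choiceType) :
  hausdorff_space (discrete_topology D * Q)%type.
Proof.
move=> z w zw.
have e1 : z.1 = w.1.
  have [v [vz vw]] := zw _ _ (discr_fst_near z) (discr_fst_near w).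
  by rewrite -vz -vw.
have e2 : z.2 = w.2.
  apply: hQ => A B zA wB.
  have [v [/= vA vB]] := zw (snd @^-1` A) (snd @^-1` B)
    (@cvg_snd _ _ _ _ _ A zA) (@cvg_snd _ _ _ _ _ B wB).
  by exists v.2.
by rewrite (surjective_pairing z) e1 e2 -surjective_pairing.
Qed.

Lemma constQ_lpc (D : choiceType) :
  locally_path_connected R (discrete_topology D * Q)%type.
Proof.
move=> [d q] U [[A B] /= [dA qB] ABU].
have [V [[Vo Vq] VB Vpc]] := lQ qB.
exists ([set d] `*` V); split.
- split; last by [].
  rewrite openE => -[e r] [/= -> Vr]; exists ([set d], V) => //=.
  by split; [exact: discrete_set1|exact: open_nbhs_nbhs].
- move=> [e r] [/= -> Vr]; apply: ABU; split => /=; last exact: VB.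
  exact: nbhs_singleton.
- move=> [e r] [e' r'] [/= -> Vr] [/= -> Vr'].
  have [g [gc g0 g1 gV]] := Vpc _ _ Vr Vr'.
  exists (fun t => (d, g t)); split; rewrite ?g0 ?g1 //.
  + move=> x; apply: (@cvg_pair _ _ _ _ (nbhs d) (nbhs (g x))).
      exact: cvg_cst.
    exact: gc.
  + by move=> t /gV.
Qed.

Definition constQ_space (D : groupType) : Qspace R Q.
Proof.
exists (discrete_topology D * Q)%type (@snd _ _).
- exact: constQ_hausdorff.
- exact: constQ_lpc.
- by move=> x; exact: cvg_snd.
Defined.

Definition constQ_mul (D : groupType) (z : fibre_square (constQ_space D)) :
  constQ_space D := (((val z).1.1 * (val z).2.1)%g, (val z).1.2).

Definition constQ_one (D : groupType) (q : Q) : constQ_space D := (1%g, q).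

Definition constQ_inv (D : groupType) (x : constQ_space D) : constQ_space D :=
  (x.1^-1%g, x.2).

Lemma constQ_mul_continuous (D : groupType) : continuous (@constQ_mul D).
Proof.
have cv : continuous (val : fibre_square (constQ_space D) -> _).
  exact: initial_continuous.
apply: continuous_discr_pair; last first.
  move=> z U zU; apply: (cv z [set w | U w.1.2]).
  exact: (@cvg_fst _ _ _ _ _ [set x | U x.2] (@cvg_snd _ _ _ _ _ U zU)).
move=> z.
have h1 := cv z _ (@cvg_fst _ _ _ _ _ _ (discr_fst_near (val z).1)).
have h2 := cv z _ (@cvg_snd _ _ _ _ _ _ (discr_fst_near (val z).2)).
have e1 : \forall w \near z, (val w).1.1 = (val z).1.1 by exact: h1.
have e2 : \forall w \near z, (val w).2.1 = (val z).2.1 by exact: h2.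
near=> w.
have -> : (val w).1.1 = (val z).1.1 by near: w.
by have -> : (val w).2.1 = (val z).2.1 by near: w.
Unshelve. all: by end_near. Qed.

Lemma constQ_one_continuous (D : groupType) : continuous (constQ_one D).
Proof.
apply: continuous_discr_pair => q; [by near=> y|exact: cvg_id].
Unshelve. all: by end_near. Qed.

Lemma constQ_fst_continuous (D E : groupType) (f : D -> E) :
  continuous (fun x : constQ_space D => (f x.1, x.2) : constQ_space E).
Proof.
apply: continuous_discr_pair; last by move=> x; exact: cvg_snd.
by move=> x; apply: filterS (discr_fst_near x) => y /= ->.
Qed.

Definition constQ (D : groupType) : Qgroup R Q.
Proof.
apply: (@Build_Qgroup R Q (constQ_space D) (@constQ_mul D) (@constQ_one D)
  (@constQ_inv D) (@constQ_mul_continuous D) (@constQ_one_continuous D)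
  (@constQ_fst_continuous D D (fun d => d^-1%g))).
- by [].
- by [].
- by [].
- by move=> [d q] [e r] [f s] hxy hyz h1 h2; rewrite /constQ_mul /= mulgA.
- by move=> [d q] h; rewrite /constQ_mul /= mul1g.
- by move=> [d q] h; rewrite /constQ_mul /= mulg1.
- by move=> [d q] h; rewrite /constQ_mul /= mulVg.
- by move=> [d q] h; rewrite /constQ_mul /= mulgV.
Defined.

Definition constQ_map (D E : groupType) (f : UMagmaMorphism.type D E) :
  Qhom (constQ D) (constQ E).
Proof.
pose fQ : Qmap (constQ D) (constQ E) :=
  @Build_Qmap R Q (constQ D) (constQ E) (fun x => (f x.1, x.2))
    (@constQ_fst_continuous D E f) (fun=> erefl).
exists fQ => -[d q] [e r] h h'.
by rewrite /fQ /= /constQ_mul /= gmulfM.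
Defined.

Definition constQ_functor : functor Groups (Qgroups R Q).
Proof.
apply: (@Functor Groups (Qgroups R Q) constQ constQ_map).
- by move=> D; apply: Qhom_ext => -[d q].
- by move=> D E F g f; apply: Qhom_ext => -[d q].
Defined.

End constant_Qgroup.

(* Main.v *)
Require Import Defs.
From HB Require Import structures.
From mathcomp Require Import all_boot all_order all_algebra.
From mathcomp Require Import all_classical all_reals all_analysis.

(** The functor D |-> D_Q has a left adjoint as soon as every Q-group [G] has a
    universal morphism to a constant Q-group
    ([left_adjoint_of_universal_arrows]). A morphism from [G] to D_Q amounts to
    a locally constant function G -> D that is multiplicative on each fibre, so
    the universal group is generated by symbols [x], for x in [G], subject to
    the relations [x][y] = [xy] for x, y in one fibre, and [x] = [y] for x, y in
    one path component. This congruence is not generated step by step but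
    defined by what it must achieve: two words in the points of [G] are
    identified when every morphism from [G] to a constant Q-group gives them the
    same value ([word_equiv]). The group axioms and the universal property
    ([unit_universal]) then reduce to computations of values; every symbol is
    invertible because the class of the fibrewise inverse of x is inverse to
    [x].

    The topology enters at one point: x |-> [x] has to be locally constant. Each
    single morphism is locally constant, but a neighbourhood is needed that
    serves all morphisms to all constant Q-groups at once. A path-connected
    neighbourhood does, since every locally constant function is constant on it
    ([locally_constant_path_connected]). *)

Set Implicit Arguments.
Unset Strict Implicit.
Unset Printing Implicit Defensive.

Import Order.TTheory Num.Theory Algebra.
Import Defs.

Local Open Scope classical_set_scope.

(** * Adjoints from universal arrows *)

(** The adjunction bijection sends u : L c -> d to F(u) o eta_c. The adjoint
    maps h : c -> c' to the factorisation of eta_c' o h through eta_c, and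
    functoriality is the uniqueness of such factorisations. *)
Lemma left_adjoint_of_universal_arrows (C D : category) (F : functor D C)
    (L : C -> D) (eta : forall c, hom c (F (L c))) :
  (forall c d (g : hom c (F d)),
    exists! u : hom (L c) d, comp (fmap F u) (eta c) = g) ->
  admits_left_adjoint F.
Proof.
move=> univ.
have lift_ex c d (g : hom c (F d)) := cid (univ c d g).
pose lift c d (g : hom c (F d)) : hom (L c) d := sval (lift_ex c d g).
have liftK c d (g : hom c (F d)) : comp (fmap F (lift c d g)) (eta c) = g.
  exact: (svalP (lift_ex c d g)).1.
have eta_inj c d (u v : hom (L c) d) :
    comp (fmap F u) (eta c) = comp (fmap F v) (eta c) -> u = v.
  by have [w [_ wP]] := univ c d (comp (fmap F v) (eta c)) => /wP <-; exact: wP.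
pose Lmap c c' (h : hom c c') : hom (L c) (L c') := lift _ _ (comp (eta c') h).
have Lmap_id c : Lmap c c (idm c) = idm (L c).
  by apply: eta_inj; rewrite liftK fmap_id comp_idl comp_idr.
have Lmap_comp a b c (g : hom b c) (f : hom a b) :
    Lmap a c (comp g f) = comp (Lmap b c g) (Lmap a b f).
  by apply: eta_inj; rewrite liftK fmap_comp -compA liftK !compA liftK.
exists (Functor Lmap_id Lmap_comp).
exists (fun c d u => comp (fmap F u) (eta c)); split=> [c d|c c' d d' u v f] /=.
  exists (lift c d) => [u|g]; last exact: liftK.
  by apply: eta_inj; rewrite liftK.
by rewrite !fmap_comp -!compA liftK.
Qed.

(** * Locally constant functions *)

(** The fibre of f through f x is clopen, so it contains the whole image of a
    path that starts at x, this image being connected. *)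
Lemma locally_constant_path_connected (R : realType) (X : topologicalType)
    (T : Type) (f : X -> T) (A : set X) (x y : X) :
  (forall z, \forall w \near z, f w = f z) -> path_connected R A ->
  A x -> A y -> f y = f x.
Proof.
move=> f_lc A_pc Ax Ay.
have [g [g_cont g0 g1 _]] := A_pc _ _ Ax Ay.
have fibre_open (P : set T) : open (f @^-1` P).
  by rewrite openE => z Pz; apply: filterS (f_lc z) => w /= ->.
have fibre_closed : closed (f @^-1` [set f x]).
  rewrite -[X in closed X]setCK; apply: open_closedC.
  exact: (fibre_open (~` [set f x])%classic).
have img_conn : connected (g @` `[0%R, 1%R]).
  exact: connected_continuous_connected (@segment_connected R 0%R 1%R) g_cont.
have in01 (t : R) : (0 <= t <= 1)%R -> (g @` `[0%R, 1%R]) (g t).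
  by move=> t01; exists t => //=; rewrite in_itv.
have img_x : (g @` `[0%R, 1%R]) x.
  by rewrite -g0; apply: in01; rewrite lexx ler01.
have img_y : (g @` `[0%R, 1%R]) y.
  by rewrite -g1; apply: in01; rewrite lexx ler01.
have imgE : g @` `[0%R, 1%R] `&` f @^-1` [set f x] = g @` `[0%R, 1%R].
  apply: img_conn; first by exists x.
  - by exists (f @^-1` [set f x]).
  - by exists (f @^-1` [set f x]).
by move: img_y; rewrite -imgE => -[].
Qed.

(** * The universal group of a Q-group *)

Section universal_group.
Variables (R : realType) (Q : topologicalType).
Hypotheses (hQ : hausdorff_space Q) (lQ : locally_path_connected R Q).

Local Notation constQ := (constQ hQ lQ).
Local Open Scope group_scope.

Section morphisms_to_constants.
Variables (G : Qgroup R Q) (D : groupType) (f : Qhom G (constQ D)).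

Lemma fst_qhomM (x y : G) (h : proj x = proj y) :
  (f (qmul (fpair h))).1 = (f x).1 * (f y).1.
Proof.
have h' : proj (f x) = proj (f y) by rewrite !qmap_proj.
by rewrite (qhomM h h').
Qed.

(** The unit is idempotent in its fibre, and 1 is the only idempotent of D. *)
Lemma fst_qhom1 (q : Q) : (f (qone G q)).1 = 1.
Proof.
have h : proj (qone G (proj (qone G q))) = proj (qone G q) by rewrite !proj_one.
have := fst_qhomM h; rewrite qmul1l proj_one => e.
by apply: (@mulgI _ (f (qone G q)).1); rewrite -e mulg1.
Qed.

Lemma fst_qhomV (x : G) : (f (qinv x)).1 = (f x).1^-1.
Proof.
have h := proj_inv x.
have := fst_qhomM h; rewrite qmulVl fst_qhom1 => e.
by apply: (@mulIg _ (f x).1); rewrite -e mulVg.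
Qed.

Lemma fst_qhom_near (x : G) : \forall y \near x, (f y).1 = (f x).1.
Proof. exact: (@qmap_continuous _ _ _ _ f x _ (discr_fst_near (f x))). Qed.

Definition word_value (s : seq G) : D := \prod_(x <- s) (f x).1.

Lemma word_value_cat (s t : seq G) :
  word_value (s ++ t) = word_value s * word_value t.
Proof. exact: big_cat. Qed.

Lemma word_value1 (x : G) : word_value [:: x] = (f x).1.
Proof. exact: big_seq1. Qed.

Lemma word_value_inv (s : seq G) :
  word_value (rev (map (@qinv _ _ G) s)) = (word_value s)^-1.
Proof.
elim: s => [|x s IHs]; first by rewrite /word_value !big_nil invg1.
rewrite map_cons rev_cons -cats1 word_value_cat IHs word_value1 fst_qhomV.
by rewrite -[x :: s]cat1s word_value_cat word_value1 invgM.
Qed.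

End morphisms_to_constants.

Variable G : Qgroup R Q.

(** Words need no formal inverses: the fibrewise inverse already supplies them.
    The quantification over all groups stays inside a proposition, so that the
    quotient is no larger than the set of words; this is what replaces the
    solution-set condition of the adjoint functor theorem. *)
Definition word_equiv (s t : seq G) : bool :=
  `[< forall (D : groupType) (f : Qhom G (constQ D)),
        word_value f s = word_value f t >].

Lemma word_equiv_refl : reflexive word_equiv.
Proof. by move=> s; apply/asboolP. Qed.

Lemma word_equiv_sym : symmetric word_equiv.
Proof. by move=> s t; apply/asboolP/asboolP => st D f; rewrite st. Qed.

Lemma word_equiv_trans : transitive word_equiv.
Proof.
by move=> t s u /asboolP st /asboolP tu; apply/asboolP => D f; rewrite st.
Qed.

Definition word_equiv_rel :=
  EquivRel word_equiv word_equiv_refl word_equiv_sym word_equiv_trans.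

Definition universal_group : Type := {eq_quot word_equiv_rel}%qT.
HB.instance Definition _ := Choice.on universal_group.

Definition word_class (s : seq G) : universal_group :=
  \pi_({eq_quot word_equiv_rel})%qT s.

Definition word_of (a : universal_group) : seq G :=
  repr (a : {eq_quot word_equiv_rel}%qT).

Lemma word_ofK : cancel word_of word_class.
Proof. exact: reprK. Qed.

Lemma word_classP (s t : seq G) :
  word_class s = word_class t <->
  forall (D : groupType) (f : Qhom G (constQ D)),
    word_value f s = word_value f t.
Proof.
split=> [/eqmodP /asboolP //|st].
by apply/eqmodP/asboolP.
Qed.

Lemma word_value_of (D : groupType) (f : Qhom G (constQ D)) (s : seq G) :
  word_value f (word_of (word_class s)) = word_value f s.
Proof. by apply: (word_classP _ _).1; rewrite word_ofK. Qed.

Definition universal_one : universal_group := word_class [::].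

Definition universal_mul (a b : universal_group) : universal_group :=
  word_class (word_of a ++ word_of b).

Definition universal_inv (a : universal_group) : universal_group :=
  word_class (rev (map (@qinv _ _ G) (word_of a))).

Lemma universal_mulA : associative universal_mul.
Proof.
move=> a b c; apply/word_classP => D f.
by rewrite !word_value_cat !word_value_of !word_value_cat mulgA.
Qed.

Lemma universal_mul1g : left_id universal_one universal_mul.
Proof.
move=> a; rewrite -[RHS]word_ofK; apply/word_classP => D f.
by rewrite word_value_cat word_value_of [word_value f [::]]big_nil mul1g.
Qed.

Lemma universal_mulg1 : right_id universal_one universal_mul.
Proof.
move=> a; rewrite -[RHS]word_ofK; apply/word_classP => D f.
by rewrite word_value_cat word_value_of [word_value f [::]]big_nil mulg1.
Qed.

Lemma universal_mulVg : left_inverse universal_one universal_inv universal_mul.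
Proof.
move=> a; apply/word_classP => D f.
by rewrite word_value_cat word_value_of word_value_inv mulVg /word_value big_nil.
Qed.

Lemma universal_mulgV : right_inverse universal_one universal_inv universal_mul.
Proof.
move=> a; apply/word_classP => D f.
by rewrite word_value_cat word_value_of word_value_inv mulgV /word_value big_nil.
Qed.

HB.instance Definition _ := isGroup.Build universal_group
  universal_mulA universal_mul1g universal_mulg1 universal_mulVg universal_mulgV.

Lemma word_class_cat (s t : seq G) :
  word_class (s ++ t) = word_class s * word_class t.
Proof.
by apply/word_classP => D f; rewrite !word_value_cat !word_value_of.
Qed.

Lemma word_class_prod (s : seq G) :
  word_class s = \prod_(x <- s) word_class [:: x].
Proof.
elim: s => [|x s IHs]; first by rewrite big_nil.
by rewrite big_cons -IHs -word_class_cat.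
Qed.

Lemma word_class_mul (x y : G) (h : proj x = proj y) :
  word_class [:: qmul (fpair h)] = word_class [:: x] * word_class [:: y].
Proof.
rewrite -word_class_cat; apply/word_classP => D f.
by rewrite word_value_cat !word_value1 fst_qhomM.
Qed.

(** The neighbourhood V must not depend on the morphism f, which is introduced
    only after V has been chosen; local path-connectedness of [G] makes this
    possible. *)
Lemma word_class_near (x : G) :
  \forall y \near x, word_class [:: y] = word_class [:: x].
Proof.
have [V [Vx _ V_pc]] := @total_lpc R Q G x setT filterT.
apply: filterS (open_nbhs_nbhs Vx) => y Vy.
apply/word_classP => D f; rewrite !word_value1.
exact: (locally_constant_path_connected (fst_qhom_near f) V_pc Vx.2 Vy).
Qed.

Definition unit_map : Qmap G (constQ universal_group) :=
  @Build_Qmap R Q G (constQ universal_group)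
    (fun x => (word_class [:: x], proj x))
    (continuous_discr_pair word_class_near (@proj_continuous R Q G))
    (fun=> erefl).

Lemma unit_mapM (x y : G) (h : proj x = proj y)
    (h' : proj (unit_map x) = proj (unit_map y)) :
  unit_map (qmul (fpair h)) = qmul (fpair h').
Proof.
by rewrite /= /constQ_mul /= word_class_mul proj_mul.
Qed.

Definition unit_hom : Qhom G (constQ universal_group) := Build_Qhom unit_mapM.

Definition extension (D : groupType) (f : Qhom G (constQ D))
  (a : universal_group) : D := word_value f (word_of a).

Lemma extension_monoid_morphism (D : groupType) (f : Qhom G (constQ D)) :
  monoid_morphism (extension f).
Proof.
split=> [|a b]; rewrite /extension word_value_of; first exact: big_nil.
exact: word_value_cat.
Qed.

HB.instance Definition _ (D : groupType) (f : Qhom G (constQ D)) :=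
  isUMagmaMorphism.Build universal_group D (extension f)
    (extension_monoid_morphism f).

(** A morphism f extends to words by its values, which is compatible with
    [word_equiv] because f is one of the morphisms quantified over there. The
    extension is unique because the classes of one-letter words generate the
    universal group. *)
Lemma unit_universal (D : groupType) (f : Qhom G (constQ D)) :
  exists! u : UMagmaMorphism.type universal_group D,
    Qhom_comp (constQ_map hQ lQ u) unit_hom = f.
Proof.
exists (extension f); split=> [|u uf].
  apply: Qhom_ext => x /=.
  rewrite /extension word_value_of word_value1.
  by rewrite -(qmap_proj f x) -surjective_pairing.
apply: ghom_ext => a; rewrite -[a]word_ofK /= /extension word_value_of.
by rewrite [in RHS]word_class_prod gmulf_prod /word_value -uf.
Qed.

End universal_group.

Theorem proposition1p7 (R : realType) (Q : topologicalType)
  (hQ : hausdorff_space Q) (cQ : connected [set: Q])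
  (lQ : locally_path_connected R Q) :
  admits_left_adjoint (constQ_functor hQ lQ).
Proof.
apply: (@left_adjoint_of_universal_arrows (Qgroups R Q) Groups
  (constQ_functor hQ lQ) (fun G => universal_group hQ lQ G : groupType)
  (unit_hom hQ lQ)).
exact: unit_universal.
Qed.
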